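(* Let $\mathbf C^* = \mathbf C\setminus\{0\}$, $\ell^1(\mathbf C^* ) = \{\mathbf x\in\ell^1(\mathbf C) : (\forall n\in\mathbf N)(\mathbf x(n)\neq 0)\}$ with the topology induced by the $\ell^1$-norm, and $\mathbf H = \{\mathbf h\in(\mathbf C^* )^{\mathbf N} : \lim_{n\to\infty}\mathbf h(n)=1\}$, with $(\mathbf h\cdot\mathbf x)(n)=\mathbf h(n)\mathbf x(n)$ for $\mathbf h\in\mathbf H$, $\mathbf x\in\ell^1(\mathbf C^* )$, $n\in\mathbf N$. Let $\mathbf P=\{\mathbf x\in\ell^1(\mathbf R):(\forall n)(\mathbf x(n)>0)\}$ and $\mathbf G=\{\mathbf g\in(0,\infty)^{\mathbf N}:\lim_n \mathbf g(n)=1\}$ with $(\mathbf g\cdot\mathbf x)(n)=\mathbf g(n)\mathbf x(n)$. Then: (i) $\mathbf H$ is a commutative Polish group under pointwise multiplication and $\mathbf G$ is a Polish subgroup of $\mathbf H$; (ii) $\mathbf H\times\ell^1(\mathbf C^* )\ni(\mathbf h,\mathbf x)\mapsto\mathbf h\cdot\mathbf x\in\ell^1(\mathbf C^* )$ is a continuous Polish group action, and the action $\mathbf G\times\mathbf P\ni(\mathbf g,\mathbf x)\mapsto\mathbf g\cdot\mathbf x\in\mathbf P$ is a subaction of it; (iii) for every $\mathbf x\in\ell^1(\mathbf C^* )$, the orbit $\mathbf H\cdot\mathbf x$ is dense in $\ell^1(\mathbf C^* )$; (iv) for every $\mathbf x\in\ell^1(\mathbf C^* )$, the orbit $\mathbf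 H\cdot\mathbf x$ is meager in $\ell^1(\mathbf C^* )$.
   Context: $\mathbf H$ is topologized by the metric $\rho(\mathbf g,\mathbf h)=\sup_{n\in\mathbf N} d(\mathbf g(n),\mathbf h(n))$ where $d(x,y)=|x-y|+|1/x-1/y|$ on $\mathbf C^*$; $\mathbf G$ is topologized by the same metric restricted to positive real sequences. $\mathbf P$ and $\ell^1(\mathbf C^* )$ carry the $\ell^1$-norm topology. *)

(* Defs.v *)
From HB Require Import structures.
From mathcomp Require Import all_boot all_order all_algebra.
From mathcomp Require Import all_classical all_reals all_analysis.
From mathcomp Require Import complex.

Set Implicit Arguments.
Unset Strict Implicit.
Unset Printing Implicit Defensive.

Import Order.TTheory GRing.Theory Num.Theory.
Import numFieldNormedType.Exports.
Import Normc.

Local Open Scope classical_set_scope.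
Local Open Scope ring_scope.
Local Open Scope complex_scope.

Definition is_metric (R : realType) (T : Type) (d : T -> T -> R) : Prop :=
  [/\ forall x y, d x y = 0 <-> x = y,
      forall x y, d x y = d y x &
      forall x y z, d x z <= d x y + d y z].

Definition metric_induces (R : realType) (T : topologicalType)
    (d : T -> T -> R) : Prop :=
  forall (x : T) (A : set T),
    nbhs x A <-> exists2 e : R, 0 < e & [set y | d x y < e] `<=` A.

Definition metric_cauchy (R : realType) (T : Type) (d : T -> T -> R)
    (u : nat -> T) : Prop :=
  forall e : R, 0 < e ->
    exists N : nat, forall m n : nat, (N <= m)%N -> (N <= n)%N ->
      d (u m) (u n) < e.

Definition completely_metrizable (R : realType) (T : topologicalType) : Prop :=
  exists d : T -> T -> R,
    [/\ is_metric d, metric_induces d &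
        forall u : nat -> T, metric_cauchy d u ->
          exists l : T, u @ \oo --> l].

Definition separable (T : topologicalType) : Prop :=
  exists A : set T, countable A /\ dense A.

Definition polish_space (R : realType) (T : topologicalType) : Prop :=
  separable T /\ completely_metrizable R T.

(* Only the carrier: continuity of the operations is [topological_group]. *)
#[short(type="preTopologicalGroupType")]
HB.structure Definition PreTopologicalGroup := {G of Topological G & Group G}.

Definition topological_group (G : preTopologicalGroupType) : Prop :=
  continuous (fun p : G * G => (p.1 * p.2)%g) /\
  continuous (fun g : G => (g^-1)%g).

Definition polish_group (R : realType) (G : preTopologicalGroupType) : Prop :=
  topological_group G /\ polish_space R G.

Definition topological_embedding (X Y : topologicalType) (f : X -> Y) : Prop :=
  injective f /\
  forall A : set X, open A <-> exists2 B : set Y, open B & A = f @^-1` B.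

(* [iota] exhibits [G] as a subgroup of [H] carrying the subspace topology. *)
Definition topological_subgroup (G H : preTopologicalGroupType)
    (iota : G -> H) : Prop :=
  {morph iota : x y / (x * y)%g >-> (x * y)%g} /\ topological_embedding iota.

Definition polish_subgroup (R : realType) (G H : preTopologicalGroupType)
    (iota : G -> H) : Prop :=
  topological_subgroup iota /\ polish_group R G.

Definition group_action (G : groupType) (X : Type) (act : G -> X -> X) : Prop :=
  (forall x : X, act 1%g x = x) /\
  (forall (g h : G) (x : X), act (g * h)%g x = act g (act h x)).

Definition continuous_polish_action (R : realType)
    (G : preTopologicalGroupType) (X : topologicalType)
    (act : G -> X -> X) : Prop :=
  [/\ polish_group R G, polish_space R X, group_action act &
      continuous (fun p : G * X => act p.1 p.2)].

Definition subaction (G H : preTopologicalGroupType) (X Y : topologicalType)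
    (iota : G -> H) (j : X -> Y)
    (actG : G -> X -> X) (actH : H -> Y -> Y) : Prop :=
  [/\ topological_subgroup iota, topological_embedding j &
      forall (g : G) (x : X), j (actG g x) = actH (iota g) (j x)].

Definition orbit_of (G X : Type) (act : G -> X -> X) (x : X) : set X :=
  [set y | exists g : G, y = act g x].

Definition nowhere_dense (T : topologicalType) (A : set T) : Prop :=
  (closure A)° = set0.

Definition meager (T : topologicalType) (A : set T) : Prop :=
  exists F : nat -> set T,
    (forall n, nowhere_dense (F n)) /\ A `<=` \bigcup_n F n.

Lemma normcB_sym (R : realType) (x y : R[i]) : normc (x - y) = normc (y - x).
Proof. by rewrite -opprB; exact: normcN. Qed.

Lemma normcB_triangle (R : realType) (y x z : R[i]) :
  normc (x - z) <= normc (x - y) + normc (y - z).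
Proof. by have := le_normcD (x - y) (y - z); rewrite addrA addrNK. Qed.

Lemma normc_geR0 (R : realType) (x : R[i]) : 0 <= normc x.
Proof. by case: x => a b; exact: sqrtr_ge0. Qed.

Lemma normcB_eq0 (R : realType) (x y : R[i]) : normc (x - y) = 0 -> x = y.
Proof. by move/eq0_normc/eqP; rewrite subr_eq0 => /eqP. Qed.

(* The topology of [R[i]^o] is that of the modulus. *)
Record seqH (R : realType) := SeqH {
  seqH_val :> nat -> R[i];
  seqH_neq0 : forall n, seqH_val n != 0;
  seqH_cvg : (seqH_val : nat -> R[i]^o) @ \oo --> (1 : R[i]^o) }.

HB.instance Definition _ (R : realType) := gen_eqMixin (seqH R).
HB.instance Definition _ (R : realType) := gen_choiceMixin (seqH R).

Lemma seqH_ext (R : realType) (h k : seqH R) : (forall n, h n = k n) -> h = k.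
Proof.
case: h k => [h h0 h1] [k k0 k1] /= hk; have {}hk : h = k by exact/funext.
by rewrite hk in h0 h1 *; congr SeqH; exact: Prop_irrelevance.
Qed.

Definition seqH_one (R : realType) : seqH R.
Proof.
by exists (fun=> 1) => [n|]; [exact: oner_neq0|exact: cvg_cst].
Defined.

Definition seqH_mul (R : realType) (h k : seqH R) : seqH R.
Proof.
exists (fun n => h n * k n) => [n|].
  by rewrite mulf_neq0 ?seqH_neq0.
rewrite -[1]mulr1; exact: (cvgM (@seqH_cvg R h) (@seqH_cvg R k)).
Defined.

Definition seqH_inv (R : realType) (h : seqH R) : seqH R.
Proof.
exists (fun n => (h n)^-1) => [n|].
  by rewrite invr_eq0 seqH_neq0.
rewrite -[1]invr1; apply: (cvgV _ (@seqH_cvg R h)); exact: oner_neq0.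
Defined.

Lemma seqH_mulA (R : realType) : associative (@seqH_mul R).
Proof. by move=> h k l; apply: seqH_ext => n /=; rewrite mulrA. Qed.

Lemma seqH_mul1 (R : realType) : left_id (@seqH_one R) (@seqH_mul R).
Proof. by move=> h; apply: seqH_ext => n /=; rewrite mul1r. Qed.

Lemma seqH_1mul (R : realType) : right_id (@seqH_one R) (@seqH_mul R).
Proof. by move=> h; apply: seqH_ext => n /=; rewrite mulr1. Qed.

Lemma seqH_mulV (R : realType) :
  left_inverse (@seqH_one R) (@seqH_inv R) (@seqH_mul R).
Proof.
by move=> h; apply: seqH_ext => n /=; rewrite mulVf ?seqH_neq0.
Qed.

Lemma seqH_Vmul (R : realType) :
  right_inverse (@seqH_one R) (@seqH_inv R) (@seqH_mul R).
Proof.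
by move=> h; apply: seqH_ext => n /=; rewrite mulfV ?seqH_neq0.
Qed.

HB.instance Definition _ (R : realType) := isGroup.Build (seqH R)
  (@seqH_mulA R) (@seqH_mul1 R) (@seqH_1mul R) (@seqH_mulV R) (@seqH_Vmul R).

Definition cstar_dist (R : realType) (x y : R[i]) : R :=
  normc (x - y) + normc (x^-1 - y^-1).

Definition rho (R : realType) (h k : seqH R) : R :=
  sup (range (fun n => cstar_dist (h n) (k n))).

Lemma cstar_dist_ge0 (R : realType) (x y : R[i]) : 0 <= cstar_dist x y.
Proof. by rewrite addr_ge0 ?normc_geR0. Qed.

Lemma seqH_bounded (R : realType) (h : seqH R) :
  exists M : R, forall n, normc (h n) <= M.
Proof.
have /cvg_seq_bounded : cvgn (h : nat -> R[i]^o).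
  by apply/cvg_ex; exists 1; exact: seqH_cvg.
move=> [M [_ /(_ (M + 1))]]; rewrite ltrDl ltr01 => /(_ isT) hM.
exists (complex.Re (M + 1)) => n; have := hM n I.
by rewrite /= (_ : `|h n| = (normc (h n))%:C) //; case: (M + 1) => a b /andP[].
Qed.

Lemma rho_has_sup (R : realType) (h k : seqH R) :
  has_sup (range (fun n => cstar_dist (h n) (k n))).
Proof.
split; first by exists (cstar_dist (h 0%N) (k 0%N)), 0%N.
have [a ha] := seqH_bounded h; have [b kb] := seqH_bounded k.
have [c hc] := seqH_bounded (seqH_inv h).
have [d kd] := seqH_bounded (seqH_inv k).
exists ((a + b) + (c + d)) => _ [n _ <-].
by rewrite lerD//; apply: (le_trans (le_normcD _ _));
  rewrite lerD ?normcN//; [exact: hc|exact: kd].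
Qed.

Lemma rho_ub (R : realType) (h k : seqH R) n :
  cstar_dist (h n) (k n) <= rho h k.
Proof. by apply: sup_upper_bound; [exact: rho_has_sup|exists n]. Qed.

Lemma rho_le (R : realType) (h k : seqH R) (M : R) :
  (forall n, cstar_dist (h n) (k n) <= M) -> rho h k <= M.
Proof.
move=> hM; apply: ge_sup; last by move=> _ [n _ <-].
by exists (cstar_dist (h 0%N) (k 0%N)), 0%N.
Qed.

Lemma rhoxx (R : realType) (h : seqH R) : rho h h = 0.
Proof.
have d0 n : cstar_dist (h n) (h n) = 0.
  by rewrite /cstar_dist !subrr normc0 addr0.
apply/eqP; rewrite eq_le; apply/andP; split.
  by apply: rho_le => n; rewrite d0.
by rewrite -(d0 0%N); exact: rho_ub.
Qed.

Lemma rho_positivity (R : realType) (h k : seqH R) : rho h k = 0 -> h = k.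
Proof.
move=> hk0; apply: seqH_ext => n; apply: normcB_eq0.
apply/eqP; rewrite eq_le normc_geR0 andbT -hk0.
by apply: le_trans (rho_ub h k n); rewrite lerDl normc_geR0.
Qed.

Lemma rho_sym (R : realType) (h k : seqH R) : rho h k = rho k h.
Proof.
congr sup; apply: eq_imagel => n _.
by rewrite /cstar_dist normcB_sym; congr (_ + _); exact: normcB_sym.
Qed.

Lemma rho_triangle (R : realType) (k h l : seqH R) :
  rho h l <= rho h k + rho k l.
Proof.
apply: rho_le => n; apply: le_trans (lerD (rho_ub h k n) (rho_ub k l n)).
by rewrite /cstar_dist addrACA lerD ?normcB_triangle.
Qed.

HB.instance Definition _ (R : realType) := isMetric.Build R (seqH R)
  (@rhoxx R) (@rho_positivity R) (@rho_sym R) (@rho_triangle R).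

Record seqG (R : realType) := SeqG {
  seqG_val :> nat -> R;
  seqG_gt0 : forall n, 0 < seqG_val n;
  seqG_cvg : seqG_val @ \oo --> (1 : R) }.

HB.instance Definition _ (R : realType) := gen_eqMixin (seqG R).
HB.instance Definition _ (R : realType) := gen_choiceMixin (seqG R).

Lemma seqG_ext (R : realType) (h k : seqG R) : (forall n, h n = k n) -> h = k.
Proof.
case: h k => [h h0 h1] [k k0 k1] /= hk; have {}hk : h = k by exact/funext.
by rewrite hk in h0 h1 *; congr SeqG; exact: Prop_irrelevance.
Qed.

Definition seqG_one (R : realType) : seqG R.
Proof. by exists (fun=> 1) => [n|]; [exact: ltr01|exact: cvg_cst]. Defined.

Definition seqG_mul (R : realType) (g k : seqG R) : seqG R.
Proof.
exists (fun n => g n * k n) => [n|].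
  by rewrite mulr_gt0 ?seqG_gt0.
rewrite -[1]mulr1; exact: (cvgM (@seqG_cvg R g) (@seqG_cvg R k)).
Defined.

Definition seqG_inv (R : realType) (g : seqG R) : seqG R.
Proof.
exists (fun n => (g n)^-1) => [n|].
  by rewrite invr_gt0 seqG_gt0.
rewrite -[1]invr1; apply: (cvgV _ (@seqG_cvg R g)); exact: oner_neq0.
Defined.

Lemma seqG_mulA (R : realType) : associative (@seqG_mul R).
Proof. by move=> h k l; apply: seqG_ext => n /=; rewrite mulrA. Qed.

Lemma seqG_mul1 (R : realType) : left_id (@seqG_one R) (@seqG_mul R).
Proof. by move=> h; apply: seqG_ext => n /=; rewrite mul1r. Qed.

Lemma seqG_1mul (R : realType) : right_id (@seqG_one R) (@seqG_mul R).
Proof. by move=> h; apply: seqG_ext => n /=; rewrite mulr1. Qed.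

Lemma seqG_mulV (R : realType) :
  left_inverse (@seqG_one R) (@seqG_inv R) (@seqG_mul R).
Proof.
by move=> h; apply: seqG_ext => n /=; rewrite mulVf ?gt_eqF ?seqG_gt0.
Qed.

Lemma seqG_Vmul (R : realType) :
  right_inverse (@seqG_one R) (@seqG_inv R) (@seqG_mul R).
Proof.
by move=> h; apply: seqG_ext => n /=; rewrite mulfV ?gt_eqF ?seqG_gt0.
Qed.

HB.instance Definition _ (R : realType) := isGroup.Build (seqG R)
  (@seqG_mulA R) (@seqG_mul1 R) (@seqG_1mul R) (@seqG_mulV R) (@seqG_Vmul R).

Lemma real_complex_neq0 (R : realType) (x : R) : 0 < x -> x%:C != 0.
Proof. by move=> x0; rewrite eq_complex /= eqxx andbT gt_eqF. Qed.

Lemma normc_real (R : realType) (x : R) : normc x%:C = `|x|.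
Proof. by rewrite /= expr0n addr0 sqrtr_sqr. Qed.

Definition seqG_incl (R : realType) (g : seqG R) : seqH R.
Proof.
exists (fun n => (g n)%:C) => [n|].
  by apply: real_complex_neq0; exact: seqG_gt0.
apply/cvgrPdist_lt => -[e e'] /=; rewrite ltcE /= => /andP[/eqP -> e0].
have /cvgrPdist_lt /(_ e e0) := @seqG_cvg R g.
apply: filterS => n gn; rewrite ltcE /=.
by rewrite eqxx /= subr0 expr0n addr0 sqrtr_sqr.
Defined.

Lemma seqG_incl_inj (R : realType) : injective (@seqG_incl R).
Proof.
move=> g k gk; apply: seqG_ext => n.
by have /(congr1 (fun h : seqH R => complex.Re (h n))) := gk.
Qed.

Definition rhoG (R : realType) (g k : seqG R) : R :=
  rho (seqG_incl g) (seqG_incl k).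

Lemma rhoGxx (R : realType) (g : seqG R) : rhoG g g = 0.
Proof. exact: rhoxx. Qed.

Lemma rhoG_positivity (R : realType) (g k : seqG R) : rhoG g k = 0 -> g = k.
Proof. by move/rho_positivity/seqG_incl_inj. Qed.

Lemma rhoG_sym (R : realType) (g k : seqG R) : rhoG g k = rhoG k g.
Proof. exact: rho_sym. Qed.

Lemma rhoG_triangle (R : realType) (k g l : seqG R) :
  rhoG g l <= rhoG g k + rhoG k l.
Proof. exact: rho_triangle. Qed.

HB.instance Definition _ (R : realType) := isMetric.Build R (seqG R)
  (@rhoGxx R) (@rhoG_positivity R) (@rhoG_sym R) (@rhoG_triangle R).

Section SeriesDist.
Context {R : realType}.
Implicit Types u v w : nat -> R.

Lemma cvg_series_dominated u v : (forall n, 0 <= u n) ->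
  (forall n, u n <= v n) -> cvgn (series v) -> cvgn (series u).
Proof.
by move=> u0 uv; apply: series_le_cvg => // n; exact: le_trans (u0 n) (uv n).
Qed.

Lemma cvg_seriesD u v :
  cvgn (series u) -> cvgn (series v) -> cvgn (series (u \+ v)).
Proof. by move=> cu cv; exact: is_cvg_seriesD. Qed.

Lemma le_term_lim_series u n : (forall n, 0 <= u n) -> cvgn (series u) ->
  u n <= limn (series u).
Proof.
move=> u0 cu.
have ndu : {homo series u : m n / (m <= n)%N >-> m <= n}.
  by apply: nondecreasing_series => *; exact: u0.
apply: le_trans (nondecreasing_cvgn_le ndu cu n.+1).
by rewrite seriesEnat /= big_nat_recr //= lerDr sumr_ge0.
Qed.

Lemma lim_series_le_add u v w : (forall n, 0 <= u n) ->
  (forall n, u n <= v n + w n) ->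
  cvgn (series v) -> cvgn (series w) ->
  limn (series u) <= limn (series v) + limn (series w).
Proof.
move=> u0 uvw cv cw; have cvw := cvg_seriesD cv cw.
rewrite -lim_seriesD //; apply: lim_series_le => //.
exact: cvg_series_dominated cvw.
Qed.

End SeriesDist.

Record ell1C (R : realType) := Ell1C {
  ell1C_val :> nat -> R[i];
  ell1C_neq0 : forall n, ell1C_val n != 0;
  ell1C_summable : cvgn (series (fun n => normc (ell1C_val n))) }.

HB.instance Definition _ (R : realType) := gen_eqMixin (ell1C R).
HB.instance Definition _ (R : realType) := gen_choiceMixin (ell1C R).

Lemma ell1C_ext (R : realType) (x y : ell1C R) : (forall n, x n = y n) -> x = y.
Proof.
case: x y => [h h0 h1] [k k0 k1] /= hk; have {}hk : h = k by exact/funext.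
by rewrite hk in h0 h1 *; congr Ell1C; exact: Prop_irrelevance.
Qed.

Definition ell1C_dist (R : realType) (x y : ell1C R) : R :=
  limn (series (fun n => normc (x n - y n))).

Lemma ell1C_dist_cvg (R : realType) (x y : ell1C R) :
  cvgn (series (fun n => normc (x n - y n))).
Proof.
apply: cvg_series_dominated (cvg_seriesD (@ell1C_summable R x)
  (@ell1C_summable R y)) => n; first exact: normc_geR0.
by apply: (le_trans (le_normcD _ _)); rewrite normcN.
Qed.

Lemma ell1C_distxx (R : realType) (x : ell1C R) : ell1C_dist x x = 0.
Proof.
rewrite /ell1C_dist (_ : series _ = fun=> 0) ?lim_cst//.
by apply/funext => n; rewrite seriesEnat /= big1 // => k _;
  rewrite subrr normc0.
Qed.

Lemma ell1C_dist_positivity (R : realType) (x y : ell1C R) :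
  ell1C_dist x y = 0 -> x = y.
Proof.
move=> xy0; apply: ell1C_ext => n; apply: normcB_eq0.
apply/eqP; rewrite eq_le normc_geR0 andbT -xy0.
apply: (@le_term_lim_series _ (fun n => normc (x n - y n))).
  by move=> m; exact: normc_geR0.
exact: ell1C_dist_cvg.
Qed.

Lemma ell1C_dist_sym (R : realType) (x y : ell1C R) :
  ell1C_dist x y = ell1C_dist y x.
Proof.
rewrite /ell1C_dist; congr (limn (series _)).
by apply/funext => n; exact: normcB_sym.
Qed.

Lemma ell1C_dist_triangle (R : realType) (y x z : ell1C R) :
  ell1C_dist x z <= ell1C_dist x y + ell1C_dist y z.
Proof.
apply: lim_series_le_add => [n|n||]; first exact: normc_geR0.
- exact: normcB_triangle.
- exact: ell1C_dist_cvg.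
- exact: ell1C_dist_cvg.
Qed.

HB.instance Definition _ (R : realType) := isMetric.Build R (ell1C R)
  (@ell1C_distxx R) (@ell1C_dist_positivity R) (@ell1C_dist_sym R)
  (@ell1C_dist_triangle R).

Definition actH (R : realType) (h : seqH R) (x : ell1C R) : ell1C R.
Proof.
exists (fun n => h n * x n) => [n|].
  by rewrite mulf_neq0 ?seqH_neq0 ?ell1C_neq0.
have [M hM] := seqH_bounded h.
apply: (@cvg_series_dominated _ _ (M *: (fun n => normc (x n)))) => [n|n|].
- exact: normc_geR0.
- by rewrite normcM ler_wpM2r ?normc_geR0.
- by apply: is_cvg_seriesZ; exact: ell1C_summable.
Defined.

Record ell1P (R : realType) := Ell1P {
  ell1P_val :> nat -> R;
  ell1P_gt0 : forall n, 0 < ell1P_val n;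
  ell1P_summable : cvgn [normed series ell1P_val] }.

HB.instance Definition _ (R : realType) := gen_eqMixin (ell1P R).
HB.instance Definition _ (R : realType) := gen_choiceMixin (ell1P R).

Lemma ell1P_ext (R : realType) (x y : ell1P R) : (forall n, x n = y n) -> x = y.
Proof.
case: x y => [h h0 h1] [k k0 k1] /= hk; have {}hk : h = k by exact/funext.
by rewrite hk in h0 h1 *; congr Ell1P; exact: Prop_irrelevance.
Qed.

Definition ell1P_dist (R : realType) (x y : ell1P R) : R :=
  limn (series (fun n => `|x n - y n|)).

Lemma ell1P_dist_cvg (R : realType) (x y : ell1P R) :
  cvgn (series (fun n => `|x n - y n|)).
Proof.
apply: cvg_series_dominated (cvg_seriesD (@ell1P_summable R x)
  (@ell1P_summable R y)) => n //.
by apply: (le_trans (ler_normD _ _)); rewrite normrN.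
Qed.

Lemma ell1P_distxx (R : realType) (x : ell1P R) : ell1P_dist x x = 0.
Proof.
rewrite /ell1P_dist (_ : series _ = fun=> 0) ?lim_cst//.
by apply/funext => n; rewrite seriesEnat /= big1 // => k _;
  rewrite subrr normr0.
Qed.

Lemma ell1P_dist_positivity (R : realType) (x y : ell1P R) :
  ell1P_dist x y = 0 -> x = y.
Proof.
move=> xy0; apply: ell1P_ext => n; apply/eqP.
rewrite -subr_eq0 -normr_le0 -xy0.
by apply: (@le_term_lim_series _ (fun n => `|x n - y n|)) => //;
  exact: ell1P_dist_cvg.
Qed.

Lemma ell1P_dist_sym (R : realType) (x y : ell1P R) :
  ell1P_dist x y = ell1P_dist y x.
Proof.
rewrite /ell1P_dist; congr (limn (series _)).
by apply/funext => n; rewrite distrC.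
Qed.

Lemma ell1P_dist_triangle (R : realType) (y x z : ell1P R) :
  ell1P_dist x z <= ell1P_dist x y + ell1P_dist y z.
Proof.
apply: lim_series_le_add => [n//|n||]; first exact: ler_distD.
- exact: ell1P_dist_cvg.
- exact: ell1P_dist_cvg.
Qed.

HB.instance Definition _ (R : realType) := isMetric.Build R (ell1P R)
  (@ell1P_distxx R) (@ell1P_dist_positivity R) (@ell1P_dist_sym R)
  (@ell1P_dist_triangle R).

Definition ell1P_incl (R : realType) (x : ell1P R) : ell1C R.
Proof.
exists (fun n => (x n)%:C) => [n|].
  by apply: real_complex_neq0; exact: ell1P_gt0.
rewrite (_ : (fun n => _) = (fun n => `|x n|)); first exact: ell1P_summable.
by apply/funext => n; exact: normc_real.
Defined.

Definition actG (R : realType) (g : seqG R) (x : ell1P R) : ell1P R.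
Proof.
exists (fun n => g n * x n) => [n|].
  by rewrite mulr_gt0 ?seqG_gt0 ?ell1P_gt0.
have := @ell1C_summable R (actH (seqG_incl g) (ell1P_incl x)).
rewrite (_ : (fun n => _) = (fun n => `|g n * x n|)) //.
by apply/funext => n; rewrite -normc_real rmorphM.
Defined.

(* Main.v *)
Require Import Defs.
From mathcomp Require Import all_boot all_order all_algebra.
From mathcomp Require Import all_classical all_reals all_analysis.
From mathcomp Require Import complex ring lra.

Set Implicit Arguments.
Unset Strict Implicit.
Unset Printing Implicit Defensive.

Import Order.TTheory GRing.Theory Num.Theory.
Import numFieldNormedType.Exports.
Import Normc.
Local Open Scope classical_set_scope.
Local Open Scope ring_scope.

(** The metric [rho] is complete because the limits of the coordinates and of
    their inverses are mutually inverse; sequences that are eventually 1 with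
    rational complex entries are dense in [seqH].  The [ell1] metric is not
    complete on [ell1C], so a truncated distance between the inverses of the
    coordinates is added to it.  [seqG] and [ell1P] embed as closed subspaces
    of [seqH] and [ell1C].  An orbit is dense since a group element may be
    prescribed on finitely many coordinates; separability of [ell1C] follows,
    as the dense orbit is a continuous image of [seqH].  The orbit of [x] is
    meager since it lies in the union over [N] of the closed sets
    [{y | forall n >= N, |y n| <= 2 |x n|}], and changing one far coordinate
    to [3 * x n] leaves such a set by an arbitrarily small move. *)

(** * Topologies induced by a metric: embeddings, separability and Polish spaces *)

Section MetricSpaces.
Context {R : realType}.

Lemma is_metric_mdist (M : metricType R) : is_metric (@mdist R M).
Proof.
split=> [x y|x y|x y z]; [split=> [|->]|exact: metric_sym|].
- exact: mdist_positivity.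
- exact: mdistxx.
- exact: metric_triangle.
Qed.

Lemma metric_induces_mdist (M : metricType R) : metric_induces (@mdist R M).
Proof.
by move=> x A; rewrite -metricType_numDomainType.filter_from_mdist_nbhs.
Qed.

Lemma is_metric_pullback (X Y : Type) (f : X -> Y) (d : Y -> Y -> R) :
  injective f -> is_metric d -> is_metric (fun x y => d (f x) (f y)).
Proof.
move=> fI [d0 dC dD]; split=> // x y; split=> [/d0/fI//|->]; exact/d0.
Qed.

Section OneMetric.
Context {X : topologicalType} {d : X -> X -> R}.
Hypotheses (dm : is_metric d) (di : metric_induces d).

Lemma metricxx x : d x x = 0.
Proof. by case: dm => d0 _ _; apply/d0. Qed.

Lemma metricC x y : d x y = d y x.
Proof. by case: dm. Qed.

Lemma metricD y x z : d x z <= d x y + d y z.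
Proof. by case: dm. Qed.

Lemma metric_cvgP (u : nat -> X) l :
  u @ \oo --> l <-> forall e, 0 < e -> \forall n \near \oo, d l (u n) < e.
Proof.
split=> [ul e e0|ul A /di[e e0 dA]].
  by apply: (ul [set y | d l y < e]); apply: (di _ _).2; exists e.
by have := ul e e0; apply: filterS => n /dA.
Qed.

Lemma metric_open_ball x e : open [set y | d x y < e].
Proof.
rewrite openE => y /= xy; apply: (di _ _).2; exists (e - d x y); rewrite ?subr_gt0//.
by move=> z /= yz; have := metricD y x z; lra.
Qed.

Lemma metric_denseP (A : set X) :
  dense A <-> forall x e, 0 < e -> exists2 y, A y & d x y < e.
Proof.
split=> [dA x e e0|dA O [x Ox] oO].
  have [|y [? ?]] := dA _ _ (metric_open_ball x e); last by exists y.
  by exists x; rewrite /= metricxx.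
have /di[e e0 eO] : nbhs x O by apply: open_nbhs_nbhs.
by have [y Ay /eO Oy] := dA x e e0; exists y.
Qed.

Lemma metric_closed (A : set X) :
  (forall x, (forall e, 0 < e -> exists2 y, A y & d x y < e) -> A x) ->
  closed A.
Proof.
move=> cA x xA; apply: cA => e e0; have [|y [? ?]] := xA [set y | d x y < e].
  by apply: (di _ _).2; exists e.
by exists y.
Qed.

End OneMetric.

Lemma metric_continuous2 (X Y Z : topologicalType) (dX : X -> X -> R)
    (dY : Y -> Y -> R) (dZ : Z -> Z -> R) (f : X -> Y -> Z) :
  metric_induces dX -> metric_induces dY -> metric_induces dZ ->
  (forall x y e, 0 < e -> exists2 a, 0 < a & forall x' y',
     dX x x' < a -> dY y y' < a -> dZ (f x y) (f x' y') < e) ->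
  continuous (fun p : X * Y => f p.1 p.2).
Proof.
move=> iX iY iZ cf [x y] A /iZ[e e0 eA]; have [a a0 fa] := cf x y e e0.
exists ([set x' | dX x x' < a], [set y' | dY y y' < a]) => /=.
  by split; [apply: (iX _ _).2|apply: (iY _ _).2]; exists a.
by move=> [x' y'] [/= xx' yy']; exact/eA/fa.
Qed.

Lemma isometry_embedding (X Y : topologicalType) (f : X -> Y)
    (dX : X -> X -> R) (dY : Y -> Y -> R) :
  is_metric dX -> metric_induces dX -> is_metric dY -> metric_induces dY ->
  (forall x y, dY (f x) (f y) = dX x y) -> topological_embedding f.
Proof.
move=> mX iX mY iY fd; split=> [x y fxy|A].
  by case: mX => X0 _ _; apply/X0; rewrite -fd fxy (metricxx mY).
split=> [|[B oB ->]].
  rewrite openE => oA.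
  (* One ball of [Y] for each ball of [X] contained in [A], with the same radius and the mapped
     centre; as [f] is an isometry, the preimage of their union is [A]. *)
  exists (\bigcup_(p in [set p : X * R | [set z | dX p.1 z < p.2] `<=` A])
    [set y | dY (f p.1) y < p.2]).
    by apply: bigcup_open => p _; exact: metric_open_ball.
  apply/seteqP; split=> [x /oA/iX[e e0 eA]|x [p pA /=]].
    by exists (x, e) => //=; rewrite (metricxx mY).
  by rewrite fd => /pA.
rewrite openE => x Bx; apply: (iX _ _).2.
have /iY[e e0 eB] : nbhs (f x) B by apply: open_nbhs_nbhs.
by exists e => // y /=; rewrite -fd => /eB.
Qed.

Lemma embedding_metric_induces (X Y : topologicalType) (f : X -> Y)
    (d : Y -> Y -> R) :
  topological_embedding f -> is_metric d -> metric_induces d ->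
  metric_induces (fun x y => d (f x) (f y)).
Proof.
move=> [_ fo] dm di x A; split=> [|[e e0 eA]].
  rewrite nbhsE => -[U [/fo[B oB UB] Ux] UA].
  rewrite {}UB in Ux UA.
  have /di[e e0 eB] : nbhs (f x) B by apply: open_nbhs_nbhs.
  by exists e => // y /eB; exact: UA.
apply: filterS eA _; apply: open_nbhs_nbhs; split=> /=.
  by apply/fo; exists [set y | d (f x) y < e] => //; exact: metric_open_ball.
by rewrite (metricxx dm).
Qed.

(** A dense set of [Y] may miss the range of [f] altogether, so for each [y] in it and each [k] one
    point of [X] whose image is within [1 / (k + 1)] of [y] is chosen, when there is one. *)
Lemma embedding_separable (X Y : topologicalType) (f : X -> Y)
    (d : Y -> Y -> R) :
  topological_embedding f -> is_metric d -> metric_induces d ->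
  separable Y -> separable X.
Proof.
move=> fe dm di [D [cD /(metric_denseP dm di) dD]].
have fdm := is_metric_pullback fe.1 dm.
have fdi := embedding_metric_induces fe dm di.
pose P (p : Y * nat) x := d p.1 (f x) < p.2.+1%:R^-1.
pose C p := if pselect (exists x, P p x) is left e then [set projT1 (cid e)]
            else set0.
exists (\bigcup_(p in D `*` setT) C p); split.
  apply: bigcup_countable; first exact: countableX.
  by move=> p _; rewrite /C; case: pselect => // e; exact: countable1.
apply/(metric_denseP fdm fdi) => x e e0.
(* Both [x] and the point chosen for [(y, k)] will be within [1 / (k + 1)] of [y], hence the
   half. *)
have [k ke] : exists k : nat, k.+1%:R^-1 < e / 2.
  have [k _ /(_ k (leqnn k))] := near_infty_natSinv_lt (PosNum (divr_gt0 e0 (ltr0Sn R 1))).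
  by exists k.
have [y Dy xy] : exists2 y, D y & d (f x) y < k.+1%:R^-1.
  by apply: dD; rewrite invr_gt0.
have Pyx : P (y, k) x by rewrite /P /= (metricC dm).
have [z Cz Pz] : exists2 z, C (y, k) z & P (y, k) z.
  rewrite /C; case: pselect => [ex|[]]; last by exists x.
  by exists (projT1 (cid ex)) => //; case: cid.
exists z; first by exists (y, k).
have := metricD dm y (f x) (f z); move: ke xy Pz; rewrite /P /=.
by move: (k.+1%:R^-1) => r; lra.
Qed.

(** The complete metric of [Y] is pulled back along [f]. The image of a Cauchy sequence converges in
    [Y], and closedness of the range brings its limit back to [X]. *)
Lemma closed_embedding_polish (X Y : topologicalType) (f : X -> Y) :
  topological_embedding f -> closed (range f) -> polish_space R Y ->
  polish_space R X.
Proof.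
move=> fe fcl [sY [d [dm di dc]]].
have fdi := embedding_metric_induces fe dm di.
split; first exact: embedding_separable fe dm di sY.
exists (fun x y => d (f x) (f y)); split=> // [|u cu].
  exact: is_metric_pullback fe.1 dm.
have [l ul] := dc (f \o u) cu.
have [x _ fx] : range f l.
  apply: fcl => B /ul[N _ uB]; exists (f (u N)).
  by split; [exists (u N)|exact: (uB N (leqnn N))].
exists x; apply/(metric_cvgP fdi) => e e0; rewrite fx.
by have /(metric_cvgP di) := ul; exact.
Qed.

Lemma dense_continuous_image_separable (X Y : topologicalType) (f : X -> Y) :
  separable X -> continuous f -> dense (range f) -> separable Y.
Proof.
move=> [D [cD dD]] cf df; exists (f @` D); split.
  exact: sub_countable (card_image_le _ _) cD.
move=> O O0 oO; have [_ [/[swap] -[x _ <-] Ofx]] := df O O0 oO.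
have [||y [Oy Dy]] := dD (f @^-1` O); last by exists (f y); split=> //; exists y.
  by exists x.
by apply: open_comp => // z _; exact: cf.
Qed.

Lemma continuous_metricP (X Y : topologicalType) (dX : X -> X -> R)
    (dY : Y -> Y -> R) (f : X -> Y) :
  metric_induces dX -> metric_induces dY ->
  (forall x e, 0 < e -> exists2 a, 0 < a & forall x',
     dX x x' < a -> dY (f x) (f x') < e) ->
  continuous f.
Proof.
move=> iX iY cf x A /iY[e e0 eA]; have [a a0 fa] := cf x e e0.
by apply: (iX _ _).2; exists a => // y xy; exact/eA/fa.
Qed.

End MetricSpaces.

(** * Continuity transported along embeddings *)

Lemma embedding_continuous (X Y : topologicalType) (f : X -> Y) :
  topological_embedding f -> continuous f.
Proof.
by move=> [_ fo]; apply/continuousP => B oB; apply/fo; exists B.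
Qed.

Lemma continuous_embedding_comp (X Y Z : topologicalType) (f : Y -> Z)
    (g : X -> Y) :
  topological_embedding f -> continuous (f \o g) -> continuous g.
Proof.
move=> [_ fo] /continuousP cfg; apply/continuousP => A /fo[B oB ->].
exact: (cfg B oB).
Qed.

(** Gives both the multiplication of [seqG] and its action on [ell1P] their continuity, from the
    corresponding maps on [seqH] and [ell1C]. *)
Lemma embedding_continuous2 (X X' Y Y' Z Z' : topologicalType) (i : X -> X')
    (j : Y -> Y') (k : Z -> Z') (f : X -> Y -> Z) (g : X' -> Y' -> Z') :
  topological_embedding i -> topological_embedding j ->
  topological_embedding k -> (forall x y, k (f x y) = g (i x) (j y)) ->
  continuous (fun p : X' * Y' => g p.1 p.2) ->
  continuous (fun p : X * Y => f p.1 p.2).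
Proof.
move=> /embedding_continuous ci /embedding_continuous cj ke kfg cg.
apply: (continuous_embedding_comp ke).
rewrite (_ : _ \o _ = (fun p => g p.1 p.2) \o (fun p : X * Y => (i p.1, j p.2))).
  move=> p; apply: continuous_comp; last exact: cg.
  apply: cvg_pair; apply: cvg_comp; [exact: cvg_fst|exact: ci|exact: cvg_snd|exact: cj].
by apply/funext => p; exact: kfg.
Qed.

(** * The modulus on [R[i]]: completeness, inversion and rational approximation *)

Section Modulus.
Context {R : realType}.
Implicit Types x y z : R[i].
Local Notation cvgC u l := ((u : nat -> R[i]^o) @ \oo --> (l : R[i]^o)).

Lemma normc_normr x : `|x| = (normc x)%:C%C.
Proof. by []. Qed.

Lemma normc_gt0 x : (0 < normc x) = (x != 0).
Proof.
rewrite lt_neqAle normc_geR0 andbT eq_sym; congr negb.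
by apply/eqP/eqP => [/eq0_normc //|->]; rewrite normc0.
Qed.

Lemma normr_Re_le x : `|complex.Re x| <= normc x.
Proof.
by case: x => a b /=; rewrite -sqrtr_sqr ler_wsqrtr ?lerDl ?sqr_ge0.
Qed.

Lemma normr_Im_le x : `|complex.Im x| <= normc x.
Proof.
by case: x => a b /=; rewrite -sqrtr_sqr ler_wsqrtr ?lerDr ?sqr_ge0.
Qed.

(** After squaring, the two sides differ by the nonnegative cross term [2 * (|a| * |b|)]. *)
Lemma normc_le_ReIm (a b : R) : normc (a +i* b)%C <= `|a| + `|b|.
Proof.
rewrite /= -[leRHS]ger0_norm ?addr_ge0// -sqrtr_sqr ler_wsqrtr//.
have := mulr_ge0 (normr_ge0 a) (normr_ge0 b).
by rewrite -[a ^+ 2]real_normK ?num_real// -[b ^+ 2]real_normK ?num_real//; nra.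
Qed.

Lemma cvg_normcP (u : nat -> R[i]) l :
  cvgC u l <-> forall e, 0 < e -> \forall n \near \oo, normc (l - u n) < e.
Proof.
split=> [/cvgrPdist_lt ul e e0|ul].
  have := ul e%:C%C; rewrite ltcR => /(_ e0).
  by apply: filterS => n; rewrite normc_normr ltcR.
apply/cvgrPdist_lt => -[e e'] /=; rewrite ltcE /= => /andP[/eqP -> e0].
by apply: filterS (ul e e0) => n un; rewrite normc_normr ltcR.
Qed.

Lemma cauchy_real_cvg (u : nat -> R) :
  (forall e, 0 < e -> exists N : nat, forall m n : nat, (N <= m)%N -> (N <= n)%N ->
    `|u m - u n| < e) -> exists l : R, u @ \oo --> l.
Proof.
move=> cu; suff : cvgn u by move=> /cvg_ex.
apply/cauchy_cvgP/cauchy_exP => _/posnumP[e]; have [N uN] := cu e%:num (gt0 e).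
exists (u N); exists N => // n /= Nn; rewrite /ball /=; exact: uN.
Qed.

Lemma cauchy_normc_cvg (u : nat -> R[i]) :
  (forall e, 0 < e -> exists N : nat, forall m n : nat, (N <= m)%N -> (N <= n)%N ->
    normc (u m - u n) < e) -> exists l, cvgC u l.
Proof.
move=> cu.
have [|a ua] := @cauchy_real_cvg (fun n => complex.Re (u n)).
  move=> e /cu[N uN]; exists N => m n Nm Nn.
  apply: le_lt_trans (uN m n Nm Nn).
  by apply: le_trans (normr_Re_le _); case: (u m) (u n) => ? ? [].
have [|b ub] := @cauchy_real_cvg (fun n => complex.Im (u n)).
  move=> e /cu[N uN]; exists N => m n Nm Nn.
  apply: le_lt_trans (uN m n Nm Nn).
  by apply: le_trans (normr_Im_le _); case: (u m) (u n) => ? ? [].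
exists (a +i* b)%C; apply/cvg_normcP => e e0.
have e20 : 0 < e / 2 by rewrite divr_gt0.
move: ua ub => /cvgrPdist_lt/(_ _ e20) ua /cvgrPdist_lt/(_ _ e20) ub.
near=> n; have uan : `|a - complex.Re (u n)| < e / 2 by near: n.
have ubn : `|b - complex.Im (u n)| < e / 2 by near: n.
move: uan ubn; case: (u n) => c d /= uan ubn.
by have := normc_le_ReIm (a - c) (b - d); rewrite /=; lra.
Unshelve. all: by end_near. Qed.

Lemma normc_invB_lt x e : x != 0 -> 0 < e -> exists2 a, 0 < a &
  forall y, normc (x - y) < a -> y != 0 /\ normc (x^-1 - y^-1) < e.
Proof.
rewrite -normc_gt0 => x0 e0.
(* The first bound forces [normc y > normc x / 2]; the second then controls the quotient
   [(y - x) / (x * y)]. *)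
exists (Num.min (normc x / 2) (normc x ^+ 2 / 2 * e)).
  by rewrite lt_min !(mulr_gt0, exprn_gt0, invr_gt0).
move=> y; rewrite lt_min => /andP[xy1 xy2].
have y2 : normc x / 2 < normc y.
  by have := normcB_triangle y x 0; rewrite !subr0; lra.
have y0 : 0 < normc y by lra.
have [x0' y0'] : x != 0 /\ y != 0 by rewrite -!normc_gt0.
split=> //; have -> : x^-1 - y^-1 = (y - x) / (x * y) by field; rewrite x0' y0'.
rewrite normcM normcV normcM normcB_sym ltr_pdivrMr ?mulr_gt0 //.
apply: lt_le_trans xy2 _; rewrite [leLHS]mulrC ler_pM2l// expr2 -mulrA ler_pM2l//.
exact: ltW.
Qed.

Lemma rat_complex_dense x e : 0 < e ->
  exists p : rat * rat, normc (x - (ratr p.1 +i* ratr p.2)%C) < e.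
Proof.
case: x => a b e0.
have [p] : exists q, ratr q \in `](a - e / 2), (a + e / 2)[.
  by apply: rat_in_itvoo; lra.
rewrite in_itv /= => /andP[pa pa'].
have [q] : exists q, ratr q \in `](b - e / 2), (b + e / 2)[.
  by apply: rat_in_itvoo; lra.
rewrite in_itv /= => /andP[qb qb'].
exists (p, q); apply: le_lt_trans (normc_le_ReIm (a - ratr p) (b - ratr q)) _.
by rewrite [e]splitr ltrD// ltr_norml; apply/andP; split; lra.
Qed.

(** The product of the two sequences is constantly 1, hence [a * b = 1]. In both completeness proofs
    this is what keeps the limits of the coordinates away from 0. *)
Lemma cvg_inv_neq0 (u : nat -> R[i]) a b : (forall n, u n != 0) ->
  cvgC u a -> cvgC (fun n => (u n)^-1) b -> a != 0 /\ b = a^-1.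
Proof.
move=> u0 ua ub; have ab : a * b = 1.
  have : cvgC (fun=> 1) (a * b).
    rewrite (_ : (fun=> 1) = (u : nat -> R[i]^o) \* (fun n => (u n)^-1)); first exact: cvgM.
    by apply/funext => n /=; rewrite divff.
  move=> /cvg_normcP ab1; apply: normcB_eq0.
  apply/eqP; rewrite eq_le normc_geR0 andbT; apply/ler_addgt0Pl => e /ab1[N _ abN].
  by rewrite addr0 ltW// (abN N (leqnn N)).
have a0 : a != 0 by apply: contra_eq_neq ab => ->; rewrite mul0r eq_sym oner_eq0.
by split=> //; apply: (mulfI a0); rewrite ab divff.
Qed.

End Modulus.

(** * The group [seqH]: continuity of the operations and completeness of [rho] *)

Section GroupH.
Context {R : realType}.
Implicit Types (h k : seqH R) (x y z : R[i]) (e : R).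
Local Notation cvgC u l := ((u : nat -> R[i]^o) @ \oo --> (l : R[i]^o)).

Lemma rho_metric : is_metric (@rho R).
Proof. exact: (@is_metric_mdist R (seqH R)). Qed.

Lemma rho_induces : metric_induces (@rho R).
Proof. exact: (@metric_induces_mdist R (seqH R)). Qed.

Lemma rho_ge0 h k : 0 <= rho h k.
Proof. exact: le_trans (cstar_dist_ge0 _ _) (rho_ub h k 0). Qed.

Lemma normcB_le_rho h k n : normc (h n - k n) <= rho h k.
Proof. by apply: le_trans (rho_ub h k n); rewrite lerDl normc_geR0. Qed.

Lemma normc_invB_le_rho h k n : normc ((h n)^-1 - (k n)^-1) <= rho h k.
Proof. by apply: le_trans (rho_ub h k n); rewrite lerDr normc_geR0. Qed.

(** Inversion exchanges the two summands of [cstar_dist]; it is therefore continuous with the same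
    radius. *)
Lemma rho_inv h k : rho (seqH_inv h) (seqH_inv k) = rho h k.
Proof.
by congr sup; apply: eq_imagel => n _; rewrite /cstar_dist /= !invrK addrC.
Qed.

(** The splitting [x * (y - y') + (x - x') * y'] calls for bounds on [x] and [y'] alone. *)
Lemma normc_mulB x y x' y' (M : R) : normc x <= M -> normc y' <= M ->
  normc (x * y - x' * y') <= M * (normc (x - x') + normc (y - y')).
Proof.
move=> xM yM; have -> : x * y - x' * y' = x * (y - y') + (x - x') * y' by ring.
apply: le_trans (le_normcD _ _) _; rewrite !normcM mulrDr addrC [leRHS]addrC.
by rewrite [leRHS]addrC mulrC lerD// ler_wpM2r// normc_geR0.
Qed.

(** Inverses of products are products of inverses, so [normc_mulB] applies to each of the two
    summands of [cstar_dist]. *)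
Lemma rho_mul_le h k h' k' (M : R) :
  (forall n, normc (h n) <= M) -> (forall n, normc (h n)^-1 <= M) ->
  (forall n, normc (k' n) <= M) -> (forall n, normc (k' n)^-1 <= M) ->
  rho (seqH_mul h k) (seqH_mul h' k') <= M * (rho h h' + rho k k').
Proof.
move=> hM hVM kM kVM; apply: rho_le => n /=.
have M0 : 0 <= M := le_trans (normc_geR0 _) (hM 0%N).
apply: le_trans (_ : M * (cstar_dist (h n) (h' n) + cstar_dist (k n) (k' n)) <= _).
  rewrite /cstar_dist !invfM addrACA mulrDr lerD ?normc_mulB//.
by rewrite ler_wpM2l// lerD// rho_ub.
Qed.

Lemma seqH_bounds h : exists2 M : R, 0 < M &
  forall n, normc (h n) <= M /\ normc (h n)^-1 <= M.
Proof.
have [a ha] := seqH_bounded h; have [b hb] := seqH_bounded (seqH_inv h).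
exists (Num.max 1 (Num.max a b)); first by rewrite lt_max ltr01.
by move=> n; have /= := hb n; have := ha n; rewrite !le_max => -> ->; rewrite !orbT.
Qed.

Lemma seqH_mul_continuous : continuous (fun p : seqH R * seqH R => (p.1 * p.2)%g).
Proof.
apply: (metric_continuous2 (f := fun h k : seqH R => (h * k)%g)
  rho_induces rho_induces rho_induces) => h k e e0.
have [M M0 hM] := seqH_bounds h; have [N N0 kN] := seqH_bounds k.
(* The entries of [k] and their inverses are bounded by [N]; requiring [rho k k' < 1] bounds those
   of [k'] by [N + 1]. *)
pose L := Num.max M (N + 1).
have L0 : 0 < L by rewrite lt_max M0.
exists (Num.min 1 (e / L / 2)); first by rewrite lt_min ltr01 !divr_gt0.
move=> h' k'; rewrite !lt_min => /andP[_ hh'] /andP[kk1 kk'].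
have kL z w : normc (z - w) <= rho k k' -> normc z <= N -> normc w <= L.
  move=> zw zN; rewrite le_max; apply/orP; right.
  by have := normcB_triangle z w 0; rewrite !subr0 (normcB_sym w z); lra.
apply: le_lt_trans (_ : L * (rho h h' + rho k k') < e); last first.
  by rewrite mulrC -ltr_pdivlMr//; lra.
apply: rho_mul_le => n.
- by rewrite le_max (hM n).1.
- by rewrite le_max (hM n).2.
- exact: kL (normcB_le_rho k k' n) (kN n).1.
- exact: kL (normc_invB_le_rho k k' n) (kN n).2.
Qed.

Lemma seqH_inv_continuous : continuous (fun h : seqH R => (h^-1)%g).
Proof.
apply: (continuous_metricP rho_induces rho_induces) => h e e0.
by exists e => // k; rewrite (_ : rho _ _ = rho h k) //; exact: rho_inv.
Qed.

Lemma cstar_dist_lim_le (u : nat -> R[i]) x z e : cvgC u x ->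
  cvgC (fun n => (u n)^-1) x^-1 ->
  (\forall n \near \oo, cstar_dist z (u n) <= e) -> cstar_dist z x <= e.
Proof.
move=> /cvg_normcP ux /cvg_normcP uVx zu; apply/ler_addgt0Pl => a a0.
have a20 : 0 < a / 2 by rewrite divr_gt0.
have [n [zun [un uVn]]] := @filter_ex _ \oo _ _
  (filterI zu (filterI (ux _ a20) (uVx _ a20))).
rewrite /cstar_dist in zun *.
have := normcB_triangle (u n) z x; have := normcB_triangle (u n)^-1 z^-1 x^-1.
rewrite (normcB_sym (u n) x) (normcB_sym (u n)^-1 x^-1); lra.
Qed.

Lemma rho_complete (u : nat -> seqH R) : metric_cauchy (@rho R) u ->
  exists l : seqH R, u @ \oo --> l.
Proof.
move=> cu.
have /choice[v uv] n : exists l, cvgC (fun m => u m n) l.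
  apply: cauchy_normc_cvg => e /cu[N uN]; exists N => m m' Nm Nm'.
  exact: le_lt_trans (normcB_le_rho _ _ n) (uN _ _ Nm Nm').
have /choice[w uw] n : exists l, cvgC (fun m => (u m n)^-1) l.
  apply: cauchy_normc_cvg => e /cu[N uN]; exists N => m m' Nm Nm'.
  exact: le_lt_trans (normc_invB_le_rho _ _ n) (uN _ _ Nm Nm').
have vw n : v n != 0 /\ w n = (v n)^-1.
  by apply: cvg_inv_neq0 (uv n) (uw n) => m; exact: seqH_neq0.
(* The second index of the Cauchy condition goes to infinity at each coordinate separately, while
   the threshold on [m] does not depend on [n]. *)
have uv_le e : 0 < e -> \forall m \near \oo, forall n, cstar_dist (u m n) (v n) <= e.
  move=> /cu[N uN]; exists N => // m Nm n; apply: cstar_dist_lim_le (uv n) _ _.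
    by rewrite -(vw n).2; exact: uw.
  by exists N => // m' Nm'; exact: le_trans (rho_ub _ _ n) (ltW (uN _ _ Nm Nm')).
(* Uniform closeness to a single [u N] carries the limit 1 of [u N] over to [v]. *)
have v1 : cvgC v 1.
  apply/cvg_normcP => e e0; have e20 : 0 < e / 2 by rewrite divr_gt0.
  have [N _ /(_ N (leqnn N)) uN] := uv_le _ e20.
  have /cvg_normcP/(_ _ e20) := @seqH_cvg R (u N); apply: filterS => n u1.
  have := normcB_triangle (u N n) 1 (v n).
  by have := uN n; have := normc_geR0 ((u N n)^-1 - (v n)^-1); rewrite /cstar_dist; lra.
exists (SeqH (fun n => (vw n).1) v1); apply/(metric_cvgP rho_induces) => e e0.
have e20 : 0 < e / 2 by rewrite divr_gt0.
apply: filterS (uv_le _ e20) => m um; rewrite rho_sym.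
by apply: (@le_lt_trans _ _ (e / 2)); [apply: rho_le|lra].
Qed.

(** * A countable dense subset of [seqH] *)

Definition ratC (p : rat * rat) : R[i] :=
  let z := (ratr p.1 +i* ratr p.2)%C in if z == 0 then 1 else z.

Lemma ratC_neq0 p : ratC p != 0.
Proof. by rewrite /ratC; case: ifPn => // _; exact: oner_neq0. Qed.

Lemma ratC1 : ratC (1, 0) = 1.
Proof.
by rewrite /ratC /= rmorph0 rmorph1; case: ifP.
Qed.

Lemma cstar_dist_ratC_dense x e : x != 0 -> 0 < e ->
  exists p, cstar_dist x (ratC p) < e.
Proof.
move=> x0 e0; have e20 : 0 < e / 2 by rewrite divr_gt0.
have [a a0 xa] := normc_invB_lt x0 e20.
have [|p] := @rat_complex_dense _ x (Num.min a (e / 2)); first by rewrite lt_min a0.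
rewrite lt_min => /andP[pa pe]; exists p; have [pn0 pV] := xa _ pa.
by rewrite /cstar_dist /ratC (negPf pn0); lra.
Qed.

Lemma cvg_eventually1 (u : nat -> R[i]) (N : nat) :
  (forall n, (N <= n)%N -> u n = 1) -> cvgC u 1.
Proof.
move=> u1; apply/cvg_normcP => e e0; exists N => // n /= Nn.
by rewrite u1// subrr normc0.
Qed.

(** The default pair [(1, 0)] is sent to 1 by [ratC], so a finite list encodes a sequence that is
    eventually 1. As [ratC] replaces 0 by 1, every list is admissible, and lists of pairs of
    rationals are countable. *)
Definition seqH_of_seq (s : seq (rat * rat)) : seqH R.
Proof.
exists (fun n => ratC (nth (1, 0) s n)) => [n|]; first exact: ratC_neq0.
by apply: (@cvg_eventually1 _ (size s)) => n sn; rewrite nth_default// ratC1.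
Defined.

Lemma seqH_of_seq_dense : dense (range seqH_of_seq).
Proof.
apply/(metric_denseP rho_metric rho_induces) => h e e0.
have e20 : 0 < e / 2 by rewrite divr_gt0.
(* In the tail, where the approximant is 1, the coordinates of [h] and their inverses each
   contribute at most [e / 4]; the first [N] coordinates are approximated one by one. *)
have [a a0 h1a] := normc_invB_lt (oner_neq0 R[i]) (divr_gt0 e20 (ltr0Sn R 1)).
have [|N _ hN] := proj1 (cvg_normcP h 1) (@seqH_cvg R h) (Num.min a (e / 2 / 2)).
  by rewrite lt_min a0 !divr_gt0.
have /choice[q hq] n := cstar_dist_ratC_dense (@seqH_neq0 _ h n) e20.
exists (seqH_of_seq (mkseq q N)); first by exists (mkseq q N).
apply: (@le_lt_trans _ _ (e / 2)); last by lra.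
apply: rho_le => n /=; have [Nn|nN] := leqP N n.
  rewrite nth_default ?size_mkseq// ratC1 /cstar_dist.
  have := hN n Nn; rewrite lt_min => /andP[/h1a[_ hV] h1].
  by rewrite normcB_sym (normcB_sym _ 1^-1); lra.
by rewrite nth_mkseq// ltW.
Qed.

Lemma seqH_separable : separable (seqH R).
Proof.
exists (range seqH_of_seq); split; last exact: seqH_of_seq_dense.
exact: sub_countable (card_image_le _ _) (countableP _).
Qed.

Lemma seqH_polish_group : polish_group R (seqH R).
Proof.
split; first by split; [exact: seqH_mul_continuous|exact: seqH_inv_continuous].
split; first exact: seqH_separable.
exists (@rho R); split; [exact: rho_metric|exact: rho_induces|exact: rho_complete].
Qed.

(** * The positive sequences as a closed subgroup of [seqH] *)

Lemma seqG_incl_embedding : topological_embedding (@seqG_incl R).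
Proof.
apply: (isometry_embedding (@is_metric_mdist R (seqG R))
  (@metric_induces_mdist R (seqG R)) rho_metric rho_induces) => g k.
by [].
Qed.

(** A limit of positive reals is a nonnegative real, and [x != 0] excludes the boundary value.
    Applied at each coordinate, this makes the ranges of [seqG_incl] and [ell1P_incl] closed. *)
Lemma complex_gt0_closed x : x != 0 ->
  (forall e, 0 < e -> exists2 a : R, 0 < a & normc (x - a%:C%C) < e) ->
  0 < complex.Re x /\ x = (complex.Re x)%:C%C.
Proof.
case: x => a b x0 xa /=.
have b0 : b = 0.
  apply/eqP; rewrite -normr_le0; apply/ler_addgt0Pl => e /xa[c c0 xc].
  rewrite addr0; apply: le_trans (ltW xc).
  by have := normr_Im_le ((a +i* b)%C - c%:C%C); rewrite /= subr0.
have a0 : 0 <= a.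
  rewrite -oppr_le0; apply/ler_addgt0Pl => e /xa[c c0 xc].
  have := normr_Re_le ((a +i* b)%C - c%:C%C); have := ler_norm (c - a).
  by rewrite distrC /=; move: xc; rewrite /=; lra.
rewrite b0 in x0 *; split=> //.
rewrite lt_neqAle a0 andbT; apply: contra_neq x0 => <-.
by [].
Qed.

Lemma seqG_incl_closed : closed (range (@seqG_incl R)).
Proof.
apply: (metric_closed rho_induces) => h hG.
have hpos n : 0 < complex.Re (h n) /\ h n = (complex.Re (h n))%:C%C.
  apply: complex_gt0_closed (@seqH_neq0 _ h n) _ => e /hG[_ [g _ <-] hg].
  by exists (g n); [exact: seqG_gt0|exact: le_lt_trans (normcB_le_rho h _ n) hg].
have h1 : (fun n => complex.Re (h n)) @ \oo --> (1 : R).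
  apply/cvgrPdist_lt => e e0.
  have /cvg_normcP/(_ _ e0) := @seqH_cvg R h; apply: filterS => n.
  by apply: le_lt_trans; apply: le_trans (normr_Re_le _); case: (h n).
exists (SeqG (fun n => (hpos n).1) h1) => //.
by apply: seqH_ext => n /=; rewrite -(hpos n).2.
Qed.

Lemma seqG_incl_morph :
  {morph @seqG_incl R : g k / (g * k)%g >-> (g * k)%g}.
Proof. by move=> g k; apply: seqH_ext => n /=; exact: rmorphM. Qed.

Lemma seqG_incl_inv (g : seqG R) : seqG_incl (g^-1)%g = ((seqG_incl g)^-1)%g.
Proof. by apply: seqH_ext => n /=; exact: fmorphV. Qed.

Lemma seqG_polish_group : polish_group R (seqG R).
Proof.
have ie := seqG_incl_embedding.
split; last exact: (closed_embedding_polish ie seqG_incl_closed seqH_polish_group.2).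
split.
  exact: (embedding_continuous2 (f := fun g k : seqG R => (g * k)%g)
    (g := fun h k : seqH R => (h * k)%g)
    ie ie ie seqG_incl_morph seqH_mul_continuous).
apply: (continuous_embedding_comp ie).
rewrite (_ : _ \o _ = (fun h : seqH R => (h^-1)%g) \o (@seqG_incl R)).
  move=> g; apply: continuous_comp; last exact: seqH_inv_continuous.
  exact: embedding_continuous.
by apply/funext => g; exact: seqG_incl_inv.
Qed.

End GroupH.

(** * The action on [ell1C]: continuity, dense orbits and Polishness of the space *)

Section Ell1.
Context {R : realType}.
Implicit Types (x y z : ell1C R) (h k : seqH R) (e : R).
Local Notation cvgC u l := ((u : nat -> R[i]^o) @ \oo --> (l : R[i]^o)).

Lemma series_le_lim (u : nat -> R) n : (forall n, 0 <= u n) ->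
  cvgn (series u) -> series u n <= limn (series u).
Proof.
by move=> u0 cu; apply: nondecreasing_cvgn_le => //; exact: nondecreasing_series.
Qed.

Lemma bounded_series_cvg (u : nat -> R) (M : R) : (forall n, 0 <= u n) ->
  (forall n, series u n <= M) -> cvgn (series u) /\ limn (series u) <= M.
Proof.
move=> u0 uM; have cu : cvgn (series u).
  apply: nondecreasing_is_cvgn; first exact: nondecreasing_series.
  by exists M => _ [n _ <-].
by split=> //; apply: limr_le => //; exact: nearW.
Qed.

Lemma lim_series_le_combination (u v w : nat -> R) (a b : R) :
  (forall n, 0 <= u n) -> (forall n, u n <= a * v n + b * w n) ->
  cvgn (series v) -> cvgn (series w) ->
  limn (series u) <= a * limn (series v) + b * limn (series w).
Proof.
move=> u0 uvw cv cw.
rewrite -[a * _]/(a *: _) -[b * _]/(b *: _) -!lim_seriesZ//.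
by apply: lim_series_le_add; rewrite //; exact: is_cvg_seriesZ.
Qed.

Lemma ell1C_metric : is_metric (@ell1C_dist R).
Proof. exact: (@is_metric_mdist R (ell1C R)). Qed.

Lemma ell1C_induces : metric_induces (@ell1C_dist R).
Proof. exact: (@metric_induces_mdist R (ell1C R)). Qed.

Lemma normcB_le_ell1C x y n : normc (x n - y n) <= ell1C_dist x y.
Proof.
apply: (@le_term_lim_series _ (fun n => normc (x n - y n))).
  by move=> m; exact: normc_geR0.
exact: ell1C_dist_cvg.
Qed.

Lemma ell1C_dist_ge0 x y : 0 <= ell1C_dist x y.
Proof. exact: le_trans (normc_geR0 _) (normcB_le_ell1C x y 0). Qed.

Lemma ell1C_dist_le x y (M : R) :
  (forall n, series (fun n => normc (x n - y n)) n <= M) -> ell1C_dist x y <= M.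
Proof. by move=> /bounded_series_cvg[] // n; exact: normc_geR0. Qed.

Lemma ell1C_cvg0 x e : 0 < e -> \forall n \near \oo, normc (x n) < e.
Proof.
move=> e0; have /cvg_series_cvg_0/cvgrPdist_lt/(_ e e0) := @ell1C_summable R x.
by apply: filterS => n; rewrite sub0r normrN ger0_norm// normc_geR0.
Qed.

Definition ell1C_norm x : R := limn (series (fun n => normc (x n))).

Lemma ell1C_norm_ge0 x : 0 <= ell1C_norm x.
Proof.
apply: le_trans (series_le_lim 0 _ (@ell1C_summable R x)).
  by rewrite /series /= big_geq.
by move=> n; exact: normc_geR0.
Qed.

Lemma ell1C_norm_le x y : ell1C_norm y <= ell1C_norm x + ell1C_dist x y.
Proof.
apply: lim_series_le_add => [n|n||]; first exact: normc_geR0.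
- by have := normcB_triangle (x n) (y n) 0; rewrite !subr0 (normcB_sym (y n)) addrC.
- exact: ell1C_summable.
- exact: ell1C_dist_cvg.
Qed.

(** Each coordinate of the difference splits as [h * (x - y) + (h - k) * y]. *)
Lemma actH_dist_le h k x y (M : R) : (forall n, normc (h n) <= M) ->
  ell1C_dist (actH h x) (actH k y) <= M * ell1C_dist x y + rho h k * ell1C_norm y.
Proof.
move=> hM; apply: lim_series_le_combination => [n|n||].
- exact: normc_geR0.
- have -> : actH h x n - actH k y n = h n * (x n - y n) + (h n - k n) * y n.
    by rewrite /=; ring.
  apply: le_trans (le_normcD _ _) _; rewrite !normcM.
  by rewrite lerD// ler_wpM2r ?normc_geR0 ?normcB_le_rho.
- exact: ell1C_dist_cvg.
- exact: ell1C_summable.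
Qed.

Lemma actH_continuous : continuous (fun p : seqH R * ell1C R => actH p.1 p.2).
Proof.
apply: (metric_continuous2 rho_induces ell1C_induces ell1C_induces) => h x e e0.
have [M M0 hM] := seqH_bounds h; have x0 := ell1C_norm_ge0 x.
(* For [y] within 1 of [x], this constant dominates [M + ell1C_norm y], the sum of the two
   coefficients in [actH_dist_le]. *)
have L0 : 0 < M + ell1C_norm x + 1 by lra.
exists (Num.min 1 (e / (M + ell1C_norm x + 1))); first by rewrite lt_min ltr01 divr_gt0.
move=> k y; rewrite !lt_min !ltr_pdivlMr// => /andP[_ hk] /andP[xy1 xy].
apply: le_lt_trans (actH_dist_le k x y (fun n => (hM n).1)) _.
have := ell1C_norm_le x y; have := rho_ge0 h k; have := ell1C_dist_ge0 x y.
have := ell1C_norm_ge0 y.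
move: (ell1C_norm x) (ell1C_norm y) (rho h k) (ell1C_dist x y) x0 L0 hk xy1 xy.
by move=> a b r d; nra.
Qed.

Lemma orbit_dense x : dense (orbit_of (@actH R) x).
Proof.
apply/(metric_denseP ell1C_metric ell1C_induces) => y e e0.
pose w n := normc (y n - x n).
have w0 n : 0 <= w n by exact: normc_geR0.
have cw : cvgn (series w) := @ell1C_dist_cvg _ y x.
have [N wN] : exists N, limn (series w) - series w N < e.
  have /cvgrPdist_lt/(_ e e0)[N _ /(_ N (leqnn N)) wN] := cw.
  by exists N; apply: le_lt_trans wN; exact: ler_norm.
(* This element carries [x] to [y] on the first [N] coordinates and fixes the others, so the
   remaining distance is a tail of [series w]. *)
pose u n := if (n < N)%N then y n / x n else 1.
have u0 n : u n != 0.
  by rewrite /u; case: ifP => _; rewrite ?oner_neq0// mulf_neq0 ?invr_eq0 ?ell1C_neq0.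
have u1 : cvgC u 1 by apply: (@cvg_eventually1 _ _ N) => n; rewrite /u ltnNge => ->.
exists (actH (SeqH u0 u1) x); first by exists (SeqH u0 u1).
apply: le_lt_trans wN; apply: ell1C_dist_le => K.
set t := (fun n => _).
have t0 n : 0 <= t n by exact: normc_geR0.
have tNK : series t K <= series t (N + K)%N.
  by apply: nondecreasing_series => //; rewrite leq_addl.
(* Going up to [N + K] lets the first [N] terms be split off, whatever [K] is; those of [t]
   vanish. *)
apply: le_trans tNK _; rewrite lerBrDr.
apply: le_trans (series_le_lim (N + K) w0 cw).
rewrite /series /= (@big_cat_nat _ _ _ N 0 (N + K)) ?leq_addr//=.
rewrite [leRHS](@big_cat_nat _ _ _ N 0 (N + K)) ?leq_addr//=.
rewrite [X in X + _ + _ <= _]big_nat_cond big1 => [|n /andP[/andP[_ nN] _]].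
  rewrite add0r addrC lerD2r big_nat_cond [leRHS]big_nat_cond.
  apply: ler_sum => n /andP[/andP[Nn _] _].
  by rewrite /t /= /u ltnNge Nn mul1r.
by rewrite /t /= /u nN mulfVK ?ell1C_neq0// subrr normc0.
Qed.

Lemma ell1C_separable : separable (ell1C R).
Proof.
(* Were there no point at all, the empty set would be dense; this spares the construction of a
   summable sequence. *)
have [[x _]|nx] := pselect (exists x : ell1C R, True); last first.
  exists set0; split; first exact: countable0.
  by move=> O [x _]; case: nx; exists x.
apply: (@dense_continuous_image_separable (seqH R) _ (fun h => actH h x)).
- exact: seqH_separable.
- apply: (continuous_metricP rho_induces ell1C_induces) => h e e0.
  have [M M0 hM] := seqH_bounds h; have x0 := ell1C_norm_ge0 x.
  (* The summand 1 makes the denominator positive, [ell1C_norm x] being known only to be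
     nonnegative. *)
  exists (e / (ell1C_norm x + 1)) => [|k]; first by rewrite divr_gt0//; lra.
  rewrite ltr_pdivlMr; last by lra.
  have := actH_dist_le k x x (fun n => (hM n).1).
  by rewrite (metricxx ell1C_metric); have := rho_ge0 h k; nra.
- move=> O O0 oO; have [_ [/[swap] -[h ->] Oy]] := @orbit_dense x O O0 oO.
  by exists (actH h x); split=> //; exists h.
Qed.


(* The truncation at [1 / (n + 1)] keeps [inv_gap] continuous on [ell1C], while
   an [inv_gap]-Cauchy sequence still has Cauchy coordinatewise inverses. *)
Definition inv_gap_at x y n : R :=
  Num.min n.+1%:R^-1 (normc ((x n)^-1 - (y n)^-1)).

Definition inv_gap x y : R := sup (range (inv_gap_at x y)).

Lemma inv_gap_at_ge0 x y n : 0 <= inv_gap_at x y n.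
Proof. by rewrite le_min invr_ge0 ler0n normc_geR0. Qed.

Lemma inv_gap_ub x y n : inv_gap_at x y n <= inv_gap x y.
Proof.
apply: sup_upper_bound; last by exists n.
split; first by exists (inv_gap_at x y 0), 0.
exists 1 => _ [m _ <-]; rewrite ge_min invf_le1 ?ltr0n// ler1n.
by rewrite orTb.
Qed.

Lemma inv_gap_le x y (M : R) : (forall n, inv_gap_at x y n <= M) -> inv_gap x y <= M.
Proof.
move=> xyM; apply: ge_sup; last by move=> _ [n _ <-].
by exists (inv_gap_at x y 0), 0.
Qed.

Lemma inv_gap_ge0 x y : 0 <= inv_gap x y.
Proof. exact: le_trans (inv_gap_at_ge0 x y 0) (inv_gap_ub x y 0). Qed.

Definition ell1C_complete_dist x y : R := ell1C_dist x y + inv_gap x y.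

Lemma ell1C_complete_dist_metric : is_metric ell1C_complete_dist.
Proof.
split=> [x y|x y|x y z].
- split=> [xy0|->].
    apply: ell1C_dist_positivity; apply/eqP.
    rewrite eq_le ell1C_dist_ge0 andbT -xy0.
    by rewrite /ell1C_complete_dist lerDl inv_gap_ge0.
  rewrite /ell1C_complete_dist ell1C_distxx add0r; apply/eqP.
  rewrite eq_le inv_gap_ge0 andbT; apply: inv_gap_le => n.
  by rewrite ge_min subrr normc0 lexx orbT.
- rewrite /ell1C_complete_dist ell1C_dist_sym; congr (_ + sup _).
  by apply: eq_imagel => n _; rewrite /inv_gap_at normcB_sym.
- rewrite /ell1C_complete_dist addrACA lerD ?ell1C_dist_triangle//.
  apply: inv_gap_le => n.
  apply: le_trans (lerD (inv_gap_ub x y n) (inv_gap_ub y z n)).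
  have := normcB_triangle (y n)^-1 (x n)^-1 (z n)^-1.
  have := normc_geR0 ((x n)^-1 - (y n)^-1).
  have := normc_geR0 ((y n)^-1 - (z n)^-1).
  have : 0 <= n.+1%:R^-1 :> R by rewrite invr_ge0.
  (* What remains is that truncation at a nonnegative level [r] is subadditive, checked case by
     case. *)
  rewrite /inv_gap_at; move: (n.+1%:R^-1) (normc _) (normc _) (normc _) => r a b c.
  by rewrite !minEle; do ?case: ifPn; rewrite -?ltNge; lra.
Qed.

(** Far coordinates are bounded by the truncation level, which is eventually below [e]; on the
    finitely many others, continuity of inversion applies. *)
Lemma inv_gap_continuous x e : 0 < e -> \forall y \near x, inv_gap x y <= e.
Proof.
move=> e0; have [N _ Ne] := near_infty_natSinv_lt (PosNum e0).
have : \forall y \near x, forall i : 'I_N, normc ((x i)^-1 - ((y : ell1C R) i)^-1) < e.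
  apply: (@filter_forall _ _
    (fun (i : 'I_N) (y : ell1C R) => normc ((x i)^-1 - (y i)^-1) < e)
    _ (nbhs_filter x)) => i.
  have [a a0 xa] := normc_invB_lt (@ell1C_neq0 _ x i) e0.
  apply: (ell1C_induces _ _).2; exists a => // y /= xy.
  exact: (xa _ (le_lt_trans (normcB_le_ell1C x y i) xy)).2.
apply: filterS => y xy; apply: inv_gap_le => n; rewrite ge_min.
have [nN|/Ne /= Nn] := ltnP n N; first by rewrite (ltW (xy (Ordinal nN))) orbT.
by rewrite (ltW Nn).
Qed.

(** The added term is nonnegative and small near [x], so the topology is still that of
    [ell1C_dist]. *)
Lemma ell1C_complete_dist_induces : metric_induces ell1C_complete_dist.
Proof.
move=> x A; split=> [/ell1C_induces[e e0 eA]|[e e0 eA]].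
  exists e => // y /= xy; apply: eA; apply: le_lt_trans xy.
  by rewrite lerDl inv_gap_ge0.
have e20 : 0 < e / 2 by rewrite divr_gt0.
have xe : \forall y \near x, ell1C_dist x y < e / 2.
  by apply: (ell1C_induces _ _).2; exists (e / 2).
apply: filterS2 xe (inv_gap_continuous x e20) => y xy1 xy2.
by apply: eA; rewrite /= /ell1C_complete_dist; lra.
Qed.

Lemma cvg_normcB (u : nat -> R[i]) (l z : R[i]) :
  cvgC u l -> (fun n => normc (z - u n)) @ \oo --> normc (z - l).
Proof.
move=> /cvg_normcP ul; apply/cvgrPdist_lt => e e0.
apply: filterS (ul e e0) => n; apply: le_lt_trans; rewrite ler_norml.
have := normcB_triangle (u n) z l; have := normcB_triangle l z (u n).
by rewrite (normcB_sym (u n) l); lra.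
Qed.

(** For fixed [n] only finitely many coordinates enter, so coordinatewise convergence suffices. A
    bound uniform in [n] then passes to the whole series. *)
Lemma series_normcB_lim_le (u : nat -> nat -> R[i]) (v z : nat -> R[i]) e n :
  (forall i, cvgC (u ^~ i) (v i)) ->
  (\forall m \near \oo, series (fun i => normc (z i - u m i)) n <= e) ->
  series (fun i => normc (z i - v i)) n <= e.
Proof.
move=> uv ue; apply: cvgr_to_le ue.
by rewrite /series /=; apply: cvg_big => [|i _];
  [exact: add_continuous|exact: cvg_normcB].
Qed.

Lemma ell1C_complete (u : nat -> ell1C R) :
  metric_cauchy ell1C_complete_dist u -> exists l : ell1C R, u @ \oo --> l.
Proof.
move=> cu.
have cu1 e : 0 < e -> exists N : nat, forall m n : nat,
    (N <= m)%N -> (N <= n)%N -> ell1C_dist (u m) (u n) < e.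
  move=> /cu[N uN]; exists N => m n Nm Nn; apply: le_lt_trans (uN m n Nm Nn).
  by rewrite lerDl inv_gap_ge0.
have /choice[v uv] n : exists l, cvgC (fun m => u m n) l.
  apply: cauchy_normc_cvg => e /cu1[N uN]; exists N => m m' Nm Nm'.
  exact: le_lt_trans (normcB_le_ell1C _ _ n) (uN _ _ Nm Nm').
have v0 n : v n != 0.
  have [|w uw] := @cauchy_normc_cvg _ (fun m => (u m n)^-1).
    (* A gap below [1 / (n + 1)] cannot come from the truncation, so it bounds the distance between
       the inverses themselves. *)
    move=> e e0; have [|N uN] := cu (Num.min e n.+1%:R^-1).
      by rewrite lt_min e0 invr_gt0 ltr0n.
    exists N => m m' Nm Nm'.
    have : inv_gap_at (u m) (u m') n < Num.min e n.+1%:R^-1.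
      apply: le_lt_trans (uN m m' Nm Nm'); apply: le_trans (inv_gap_ub _ _ n) _.
      by rewrite lerDr ell1C_dist_ge0.
    by rewrite lt_min !gt_min ltxx /= => /andP[/orP[ne|//] nn]; exact: lt_trans nn ne.
  by have [] := cvg_inv_neq0 (fun m => @ell1C_neq0 _ (u m) n) (uv n) uw.
have uvS e : 0 < e -> \forall m \near \oo, forall n,
    series (fun i => normc (u m i - v i)) n <= e.
  move=> /cu1[N uN]; exists N => // m Nm n.
  apply: (series_normcB_lim_le (u := fun m i => u m i)) => //.
  exists N => // m' Nm'; apply: le_trans (ltW (uN m m' Nm Nm')).
  apply: series_le_lim; last exact: ell1C_dist_cvg.
  by move=> k; exact: normc_geR0.
have vS : cvgn (series (fun i => normc (v i))).
  (* The partial sums for [u N - v] are bounded by 1; adding the summable [u N] shows that [v] is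
     summable. *)
  have [N _ /(_ N (leqnn N)) /bounded_series_cvg[|cuv _]] := uvS 1 ltr01.
    by move=> k; exact: normc_geR0.
  apply: cvg_series_dominated (cvg_seriesD cuv (@ell1C_summable _ (u N))) => k.
    exact: normc_geR0.
  have := normcB_triangle (u N k) (v k) 0.
  by rewrite !subr0 (normcB_sym (v k)).
exists (Ell1C v0 vS); apply/(metric_cvgP ell1C_induces) => e e0.
have e20 : 0 < e / 2 by rewrite divr_gt0.
apply: filterS (uvS _ e20) => m um; rewrite ell1C_dist_sym.
by apply: (@le_lt_trans _ _ (e / 2)); [exact: ell1C_dist_le|lra].
Qed.

Lemma ell1C_polish : polish_space R (ell1C R).
Proof.
split; first exact: ell1C_separable.
exists ell1C_complete_dist; split; first exact: ell1C_complete_dist_metric.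
- exact: ell1C_complete_dist_induces.
- exact: ell1C_complete.
Qed.

(** * Orbits are meager *)

Definition eventually_le2 x N : set (ell1C R) :=
  [set y | forall n, (N <= n)%N -> normc (y n) <= 2 * normc (x n)].

Lemma eventually_le2_closed x N : closed (eventually_le2 x N).
Proof.
apply: (metric_closed ell1C_induces) => y yF n Nn.
apply/ler_addgt0Pl => e /yF[z zF yz].
have := zF n Nn; have := normcB_le_ell1C y z n.
by have := normcB_triangle (z n) (y n) 0; rewrite !subr0; lra.
Qed.

Lemma eventually_le2_nowhere_dense x N : nowhere_dense (eventually_le2 x N).
Proof.
rewrite /nowhere_dense -(closure_id _).1; last exact: eventually_le2_closed.
rewrite -subset0 => y /ell1C_induces[e e0 eF].
(* Replacing [y n] by [3 * x n] costs at most [normc (y n) + 3 * normc (x n)], hence at most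
   [5 * normc (x n)], which must stay below [e]. *)
have [n [Nn xne]] : exists n, (N <= n)%N /\ normc (x n) < e / 5.
  apply: (@filter_ex _ \oo); apply: filterI; first by exists N.
  by apply: ell1C_cvg0; rewrite divr_gt0.
have xn0 : 0 < normc (x n) by rewrite normc_gt0 ell1C_neq0.
have yn : normc (y n) <= 2 * normc (x n).
  by apply: eF Nn; rewrite /= (metricxx ell1C_metric).
(* The change at coordinate [n] is made by a group element, so the new point is in [ell1C] by
   construction. *)
pose u (i : nat) := if i == n then 3 * x n / y n else 1.
have u0 i : u i != 0.
  rewrite /u; case: ifP => _; rewrite ?oner_neq0//.
  by rewrite !mulf_neq0 ?invr_eq0 ?ell1C_neq0 ?pnatr_eq0.
have u1 : cvgC u 1.
  by apply: (@cvg_eventually1 _ _ n.+1) => k nk; rewrite /u gtn_eqF.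
pose z := actH (SeqH u0 u1) y.
have zn : z n = 3 * x n by rewrite /z /= /u eqxx mulfVK ?ell1C_neq0.
have normc3 : normc (3 : R[i]) = 3.
  by rewrite -[3 in LHS](rmorph_nat (real_complex R)) normc_real ger0_norm.
have yz : ell1C_dist y z <= 5 * normc (x n).
  apply: ell1C_dist_le => K; rewrite /series /=.
  (* The partial sum is its term of index [n] when [n < K], and 0 otherwise. *)
  rewrite (eq_bigr (fun i => if i == n then normc (y n - z n) else 0)).
    rewrite -big_mkcond big_nat1_eq; case: ifP => _; last by rewrite mulr_ge0// ltW.
    have := le_normcD (y n) (- z n); rewrite normcN zn normcM normc3; lra.
  move=> k _; rewrite /u; case: eqP => [->|_]; first by rewrite /z /= /u eqxx.
  by rewrite mul1r subrr normc0.
have /(_ n Nn) : eventually_le2 x N z by apply: eF => /=; lra.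
by rewrite zn normcM normc3; lra.
Qed.

Lemma orbit_meager x : meager (orbit_of (@actH R) x).
Proof.
exists (eventually_le2 x); split; first exact: eventually_le2_nowhere_dense.
(* From some [N] on, [h n] is within 1 of 1, so its modulus is at most 2. *)
move=> _ [h ->]; have [N _ hN] := (cvg_normcP h 1).1 (@seqH_cvg R h) 1 ltr01.
exists N => // n Nn; rewrite /= normcM ler_wpM2r ?normc_geR0//.
have := hN n Nn; have := normcB_triangle 1 (h n) 0.
by rewrite !subr0 normc1 (normcB_sym (h n)); lra.
Qed.

(** * The positive summable sequences as a closed subspace, and the subaction *)

Lemma ell1P_incl_embedding : topological_embedding (@ell1P_incl R).
Proof.
apply: (isometry_embedding (@is_metric_mdist R (ell1P R))
  (@metric_induces_mdist R (ell1P R)) ell1C_metric ell1C_induces) => x y.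
congr (limn (series _)); apply/funext => n.
by rewrite -[RHS]normc_real rmorphB.
Qed.

Lemma ell1P_incl_closed : closed (range (@ell1P_incl R)).
Proof.
apply: (metric_closed ell1C_induces) => x xP.
have xpos n : 0 < complex.Re (x n) /\ x n = (complex.Re (x n))%:C%C.
  apply: complex_gt0_closed (@ell1C_neq0 _ x n) _ => e /xP[_ [y _ <-] xy].
  by exists (y n); [exact: ell1P_gt0|exact: le_lt_trans (normcB_le_ell1C x _ n) xy].
have xS : cvgn [normed series (fun n => complex.Re (x n))].
  rewrite (_ : [normed series _] = series (fun n => normc (x n))).
    exact: ell1C_summable.
  by congr series; apply/funext => n /=; rewrite [in RHS](xpos n).2 normc_real.
exists (Ell1P (fun n => (xpos n).1) xS) => //.
by apply: ell1C_ext => n /=; rewrite -(xpos n).2.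
Qed.

Lemma ell1P_incl_act (g : seqG R) (x : ell1P R) :
  ell1P_incl (actG g x) = actH (seqG_incl g) (ell1P_incl x).
Proof. by apply: ell1C_ext => n /=; exact: rmorphM. Qed.

Lemma actH_group_action : group_action (@actH R).
Proof.
by split=> [x|h k x]; apply: ell1C_ext => n /=; rewrite ?mul1r ?mulrA.
Qed.

Lemma actG_group_action : group_action (@actG R).
Proof.
by split=> [x|g k x]; apply: ell1P_ext => n /=; rewrite ?mul1r ?mulrA.
Qed.

End Ell1.

Theorem theorem1p7 (R : realType) :
  [/\ (* (i) *)
      [/\ commutative (fun h k : seqH R => (h * k)%g),
          polish_group R (seqH R) &
          polish_subgroup R (@seqG_incl R)],
      (* (ii) *)
      [/\ continuous_polish_action R (@actH R),
          continuous_polish_action R (@actG R) &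
          subaction (@seqG_incl R) (@ell1P_incl R) (@actG R) (@actH R)],
      (* (iii) *)
      forall x : ell1C R, dense (orbit_of (@actH R) x) &
      (* (iv) *)
      forall x : ell1C R, meager (orbit_of (@actH R) x)].
Proof.
have [gP gG] := (@seqH_polish_group R, @seqG_polish_group R).
have iota_sub : topological_subgroup (@seqG_incl R).
  by split; [exact: seqG_incl_morph|exact: seqG_incl_embedding].
split; [split|split|exact: orbit_dense|exact: orbit_meager] => //.
- by move=> h k; apply: seqH_ext => n /=; exact: mulrC.
- split=> //; [exact: ell1C_polish|exact: actH_group_action|exact: actH_continuous].
- split=> //; last 1 first.
  + exact: (embedding_continuous2 (@seqG_incl_embedding R)
      (@ell1P_incl_embedding R) (@ell1P_incl_embedding R)
      (@ell1P_incl_act R) (@actH_continuous R)).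
  + exact: closed_embedding_polish (@ell1P_incl_embedding R)
      (@ell1P_incl_closed R) (@ell1C_polish R).
  + exact: actG_group_action.
- by split=> //; [exact: ell1P_incl_embedding|exact: ell1P_incl_act].
Qed.
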